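(* Let $m$ be a positive integer. Define $$a_0=1\quad\text{and}\quad a_n=\sum_{j=1}^{n}\ \sum_{\substack{i_1+i_2+\cdots+i_j=n\\ 1\leqslant i_1,i_2,\ldots,i_j\leqslant m-1}}\frac{n!}{i_1!\,i_2!\cdots i_j!}\quad\text{for every positive integer } n,$$ where the inner sum is over all $j$-tuples $(i_1,\ldots,i_j)$ of integers satisfying the stated conditions. Then for every nonnegative integer $n$ and every positive integer $k$ we have $r_m(n,0)=a_n$ and $$r_m(n,k)=\sum_{l=km}^{n}\binom{n}{l}\,a_{n-l}\sum_{\substack{l_1+l_2+\cdots+l_k=l\\ l_1,l_2,\ldots,l_k\geqslant m}}\frac{l!}{l_1!\,l_2!\cdots l_k!}\prod_{i=1}^{k}\left[\sum_{j=m}^{l_i}\binom{l_i}{j}a_{l_i-j}\right],$$ where the middle sum is over all $k$-tuples $(l_1,\ldots,l_k)$ of integers satisfying the stated conditions.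
   Context: An outcome of a race among $n$ distinct participants is an ordered partition of an $n$-element set, i.e. a finite sequence of pairwise disjoint nonempty subsets (blocks) whose union is the whole set. A tie of size $s$ is a block with exactly $s$ elements (so $s=1$ is allowed). For positive integers $n, m$ and a nonnegative integer $k$, $r_m(n,k)$ denotes the number of outcomes of a race among $n$ distinct participants that contain exactly $k$ ties of size at least $m$, i.e. the number of ordered partitions of an $n$-element set having exactly $k$ blocks of cardinality at least $m$ (the other blocks having cardinality less than $m$). Conventions: $r_m(0,0)=1$ and $r_m(0,k)=0$ for $k\geqslant 1$. Empty sums are $0$ (so, for instance, the formula for $r_m(n,k)$ gives $0$ when $n<km$, and $a_n=0$ for $n\geqslant 1$ when $m=1$). *)

(* Defs.v *)
From mathcomp Require Import all_boot.

Set Implicit Arguments.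
Unset Strict Implicit.
Unset Printing Implicit Defensive.

Definition ordered_partition (T : finType) (s : seq {set T}) : bool :=
  [&& set0 \notin s,
      pairwise (fun A B : {set T} => [disjoint A & B]) s
    & \bigcup_(B <- s) B == [set: T]].

Definition nb_ties (T : finType) (m : nat) (s : seq {set T}) : nat :=
  count (fun B : {set T} => m <= #|B|) s.

(* The type [n.-bseq _] of sequences of length at most n makes the set finite;
   no ordered partition is lost, by [size_ordered_partition] below. *)
Definition race (m n k : nat) : nat :=
  #|[set s : n.-bseq {set 'I_n} | ordered_partition s & nb_ties m s == k]|.

(* The division is exact whenever the [i u] sum to n: see [dvdn_multinom]. *)
Definition multinom (n j : nat) (i : 'I_j -> nat) : nat :=
  n`! %/ \prod_(u < j) (i u)`!.

(* Tuples of nonnegative integers with sum n have all entries at most n, hence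
   the range ['I_n.+1]. *)
Definition small_races (m n : nat) : nat :=
  if n == 0 then 1 else
  \sum_(1 <= j < n.+1)
    \sum_(i : {ffun 'I_j -> 'I_n.+1} |
          (\sum_(u < j) i u == n) && [forall u, 1 <= i u <= m - 1])
      multinom n (fun u => i u).

Lemma size_ordered_partition (T : finType) (s : seq {set T}) :
  ordered_partition s -> size s <= #|T|.
Proof.
case/and3P=> s0 dis _.
suff: size s <= #|\bigcup_(B <- s) B|.
  by move/leq_trans; apply; apply: max_card.
elim: s s0 dis => [|A s IHs] //=; rewrite inE negb_or => /andP[A0 s0].
case/andP=> disA dis; rewrite big_cons cardsU.
have -> : A :&: \bigcup_(B <- s) B = set0.
  rewrite big_distrr /= big_seq big1 // => B Bs.
  by apply/eqP; rewrite setI_eq0; apply: (allP disA).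
rewrite cards0 subn0 -add1n leq_add ?IHs //.
by rewrite card_gt0 eq_sym.
Qed.

Lemma dvdn_multinom (j : nat) (i : 'I_j -> nat) :
  \prod_(u < j) (i u)`! %| (\sum_(u < j) i u)`!.
Proof.
elim: j i => [|j IHj] i; first by rewrite !big_ord0.
rewrite !big_ord_recl /= -(bin_fact (leq_addr (\sum_(u < j) i (lift ord0 u)) _)).
by rewrite addKn; apply: dvdn_mull; apply: dvdn_mul.
Qed.

Lemma race0 (m k : nat) : race m 0 k = (k == 0).
Proof.
have T0 : [set: 'I_0] = set0 by apply/setP=> -[].
rewrite /race; case: eqP => [->|/eqP k0]; last first.
  apply: eq_card0 => -[[|//] s0]; rewrite inE /nb_ties /= eq_sym (negbTE k0).
  by rewrite andbF.
apply: etrans (cards1 ([bseq] : 0.-bseq {set 'I_0})); apply: eq_card.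
move=> -[[|//] s0]; rewrite !inE /ordered_partition /= big_nil T0 !eqxx.
by apply/esym/eqP/val_inj.
Qed.

(* Main.v *)
Require Import Defs.
From mathcomp Require Import all_boot all_algebra ring.

(** In terms of exponential generating functions, let S(x) be the sum of
    x^i/i! over the block sizes i between 1 and m-1, and L(x) the sum over the
    sizes i >= m.  The [small_races m] have generating function
    A = 1 + S + S^2 + ..., that is, A = 1 + S A.  Deleting the first
    block of an ordered partition shows that the generating functions R_k of
    the ordered partitions with k blocks of size at least m satisfy
      R_0 = 1 + S R_0   and   R_k = S R_k + L R_(k-1)  for k > 0,
    and A (L A)^k solves this recurrence, because
      A (L A)^k = (1 + S A) (L A)^k = (L A)^k + S (A (L A)^k)
    and (L A)^k = L (A (L A)^(k-1)).  The formula to be proved is the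
    coefficient of x^n/n! in (L A)^k A, with the power expanded into a sum over
    k-tuples.

    The product of such series is [binconv], the binomial convolution of their
    sequences of coefficients.  Associativity, commutativity and the expansion
    of powers ([binpowE]) are inherited from products of rational polynomials.
    [small_races_rec] and [tied_races_rec] are the two identities above, and
    [count_ties] matches the latter with the removal of the first block, along
    an explicit enumeration of the ordered partitions of a finite set. *)

Set Implicit Arguments.
Unset Strict Implicit.
Unset Printing Implicit Defensive.

(** * Binomial convolution *)

Definition binconv (f g : nat -> nat) (n : nat) : nat :=
  \sum_(j < n.+1) 'C(n, j) * (f j * g (n - j)).

Definition binpow (f : nat -> nat) (k : nat) : nat -> nat :=
  iter k (binconv f) (fun n => n == 0).

Lemma eq_binconv (f f' g g' : nat -> nat) n :
  (forall i, i <= n -> f i = f' i) -> (forall i, i <= n -> g i = g' i) ->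
  binconv f g n = binconv f' g' n.
Proof.
by move=> ff gg; apply: eq_bigr => -[j ?] _; rewrite ff ?gg ?leq_subr.
Qed.

Lemma binconvDl (f f' g : nat -> nat) n :
  binconv (fun i => f i + f' i) g n = binconv f g n + binconv f' g n.
Proof.
by rewrite /binconv -big_split; apply: eq_bigr => j _; rewrite mulnDl mulnDr.
Qed.

Lemma binconv_sumr (I : Type) (r : seq I) f (g : I -> nat -> nat) n :
  binconv f (fun i => \sum_(u <- r) g u i) n = \sum_(u <- r) binconv f (g u) n.
Proof.
rewrite exchange_big; apply: eq_bigr => j _ /=.
by rewrite !big_distrr.
Qed.

Lemma binconv1n f n : binconv (fun i => i == 0) f n = f n.
Proof.
rewrite /binconv big_ord_recl big1 => [|j _]; last by rewrite mul0n muln0.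
by rewrite bin0 !mul1n subn0 addn0.
Qed.

(** * Truncated exponential generating functions *)

Section GeneratingFunction.
Import GRing.Theory Num.Theory.
Local Open Scope ring_scope.

(** Only the coefficients up to N are constrained, so that polynomials can stand
    for power series: a coefficient of a product depends on no later
    coefficient of the factors. *)
Definition is_egf (N : nat) (f : nat -> nat) (p : {poly rat}) : Prop :=
  forall i : nat, (i <= N)%N -> p`_i = (f i)%:R / i`!%:R.

Lemma is_egf_poly N f :
  is_egf N f (\poly_(i < N.+1) ((f i)%:R / i`!%:R)).
Proof. by move=> i leiN; rewrite coef_poly ltnS leiN. Qed.

Let factr_neq0 n : n`!%:R != 0 :> rat.
Proof. by rewrite pnatr_eq0 -lt0n fact_gt0. Qed.

Lemma is_egf_inj N f g p i :
  is_egf N f p -> is_egf N g p -> (i <= N)%N -> f i = g i.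
Proof.
move=> fp gp leiN; have := fp i leiN; rewrite gp // => /(mulIf _) fg.
by apply/eqP; rewrite -(eqr_nat rat) fg // invr_eq0.
Qed.

(** The binomial coefficient in the convolution is exactly what the
    factorials in the denominators produce. *)
Lemma is_egfM N f g p q :
  is_egf N f p -> is_egf N g q -> is_egf N (binconv f g) (p * q).
Proof.
move=> fp gq i leiN; rewrite coefM natr_sum mulr_suml.
apply: eq_bigr => j _; have leji: (j <= i)%N by rewrite -ltnS.
rewrite fp ?gq ?(leq_trans _ leiN) ?leq_subr // -(bin_fact leji) !natrM.
by field; rewrite !factr_neq0 pnatr_eq0 -lt0n bin_gt0.
Qed.

Lemma is_egfX N f p k : is_egf N f p -> is_egf N (binpow f k) (p ^+ k).
Proof.
move=> fp; elim: k => [|k IHk]; last by rewrite exprS; apply: is_egfM.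
by move=> [|i] _; rewrite coef1 ?divr1 ?mul0r.
Qed.

Lemma binconvC f g n : binconv f g n = binconv g f n.
Proof.
have [F G] := (@is_egf_poly n f, @is_egf_poly n g).
apply: (is_egf_inj (is_egfM F G) _ (leqnn n)).
by rewrite mulrC; apply: is_egfM.
Qed.

Lemma binconvA f g h n :
  binconv f (binconv g h) n = binconv (binconv f g) h n.
Proof.
have [F G H] := And3 (@is_egf_poly n f) (@is_egf_poly n g) (@is_egf_poly n h).
apply: (is_egf_inj (is_egfM F (is_egfM G H)) _ (leqnn n)).
by rewrite mulrA; apply: is_egfM H; apply: is_egfM.
Qed.

(** Expand the k-th power of the polynomial with coefficients f i / i! by
    distributivity: each choice t of one term per factor contributes to the
    monomial whose exponent is the sum of t. *)
Lemma binpowE f k n :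
  binpow f k n =
    (\sum_(t : {ffun 'I_k -> 'I_n.+1} | \sum_(u < k) t u == n)
      multinom n (fun u => t u) * \prod_(u < k) f (t u))%N.
Proof.
apply/eqP; rewrite -(eqr_nat rat); apply/eqP.
have /(_ n (leqnn n)) /(congr1 ( *%R^~ n`!%:R)) := is_egfX k (@is_egf_poly n f).
rewrite mulfVK // => <-; rewrite poly_def -(card_ord k) -prodr_const card_ord.
rewrite bigA_distr_bigA coef_sum mulr_suml natr_sum [RHS]big_mkcond.
apply: eq_bigr => t _; rewrite scaler_prod prodrXr coefZ coefXn eq_sym.
case: eqP => [tn|_]; last by rewrite mulr0 mul0r.
have dvd: (\prod_(u < k) (t u)`! %| n`!)%N.
  by have := dvdn_multinom (fun u => t u); rewrite tn.
rewrite mulr1 natrM natf_div // prodf_div !natr_prod.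
by rewrite [RHS]mulrC mulrAC mulrA.
Qed.

End GeneratingFunction.

(** With a = 1, this cuts the geometric series of S after finitely many powers;
    with a = m, it gives the lower bound k * m of the sum in the theorem. *)
Lemma binpow_eq0 f a k n :
  (forall i, i < a -> f i = 0) -> n < k * a -> binpow f k n = 0.
Proof.
move=> f0; elim: k n => [|k IHk] n //=; rewrite mulSn => lt_n.
apply: big1 => j _; have [/f0->|leaj] := ltnP j a; first by rewrite muln0.
by rewrite IHk ?muln0 // ltn_subLR ?(leq_trans lt_n) ?leq_add2r // -ltnS.
Qed.

(** When f vanishes outside P, the tuples with an entry outside P
    contribute a zero product.  The conditions on parts in the two formulas of
    the theorem arise in this way. *)
Lemma binpow_support (P : pred nat) f k n :
  (forall i, ~~ P i -> f i = 0) ->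
  binpow f k n =
    \sum_(t : {ffun 'I_k -> 'I_n.+1} |
          (\sum_(u < k) t u == n) && [forall u, P (t u)])
      multinom n (fun u => t u) * \prod_(u < k) f (t u).
Proof.
move=> f0; rewrite binpowE big_mkcondr; apply: eq_bigr => t _.
case: ifPn => // /forallPn[u /f0 fu0].
by rewrite (bigD1 u) //= fu0 mul0n muln0.
Qed.

(** * Short and long blocks *)

Section Sizes.
Variable m : nat.

(** The coefficients of S and of L. *)
Definition short (i : nat) : nat := 1 <= i <= m - 1.
Definition long (i : nat) : nat := m <= i.

(** A = 1 + S + S^2 + ... .  Since S has no constant term, the powers
    beyond the n-th do not contribute to the n-th coefficient; the freedom
    in b lets the same truncation serve for all coefficients up to n. *)
Lemma small_racesE n b :
  n < b -> small_races m n = \sum_(j < b) binpow short j n.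
Proof.
move=> lt_nb.
have short0 j : n < j -> binpow short j n = 0.
  by move=> ltnj; apply: (@binpow_eq0 _ 1); rewrite ?muln1 // => -[].
have -> : \sum_(j < b) binpow short j n = \sum_(j < n.+1) binpow short j n.
  rewrite (big_ord_widen b (fun j => binpow short j n) lt_nb).
  rewrite [RHS]big_mkcond; apply: eq_bigr => j _.
  by case: ifPn => //; rewrite ltnS -ltnNge => /short0.
rewrite /small_races; case: eqP => [->|/eqP n0].
  by rewrite big_ord_recl big_ord0.
rewrite big_ord_recl /= (negbTE n0) add0n big_add1 big_mkord.
apply: eq_bigr => j _; rewrite add0n -[RHS]/(binpow short j.+1 n).
rewrite (@binpow_support (fun i => 1 <= i <= m - 1)) => [|i /negbTE]; last first.
  by rewrite /short => ->.
apply: eq_bigr => t /andP[_ /forallP st].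
by rewrite big1 ?muln1 // => u _; rewrite /short st.
Qed.

(** A = 1 + S A, by shifting the geometric series. *)
Lemma small_races_rec n :
  small_races m n = (n == 0) + binconv short (small_races m) n.
Proof.
rewrite (@eq_binconv _ short _
  (fun i => \sum_(j < n.+1) binpow short j i)) // => [|i lein]; last first.
  exact: small_racesE.
by rewrite binconv_sumr (@small_racesE n n.+2) // big_ord_recl.
Qed.

(** The coefficients of A (L A)^k. *)
Definition tied_races (k : nat) : nat -> nat :=
  binconv (small_races m) (binpow (binconv long (small_races m)) k).

(** Replace the leading factor A of A (L A)^k by 1 + S A.  Combinatorially, the
    first block, if any, is long and leaves one tie fewer, or is short. *)
Lemma tied_races_rec k n :
  tied_races k n =
    (if k is k'.+1 then binconv long (tied_races k') n else n == 0)
    + binconv short (tied_races k) n.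
Proof.
rewrite {1}/tied_races.
rewrite (eq_binconv (fun i _ => small_races_rec i) (fun i _ => erefl)).
rewrite binconvDl binconv1n -binconvA; congr (_ + _).
by case: k => [//|k]; rewrite /= -binconvA.
Qed.

End Sizes.

(** * Enumerating ordered partitions by their first block *)

Section OrderedPartitions.
Variable T : finType.
Implicit Types (B D : {set T}) (s : seq {set T}).

(** Removing the first block leaves an ordered partition of a smaller subset
    of T, hence the need to partition an arbitrary D; [ordered_partition] is
    the case where D is [[set: T]]. *)
Definition ordered_partition_of D s : bool :=
  [&& set0 \notin s,
      pairwise (fun A B : {set T} => [disjoint A & B]) s
    & \bigcup_(B <- s) B == D].

Lemma ordered_partition_of_nil D : ordered_partition_of D [::] = (D == set0).
Proof. by rewrite /ordered_partition_of big_nil eq_sym. Qed.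

Lemma ordered_partition_of_cons D B s :
  ordered_partition_of D (B :: s) =
    [&& B != set0, B \subset D & ordered_partition_of (D :\: B) s].
Proof.
have disjE r : all (fun A : {set T} => [disjoint B & A]) r
    = [disjoint B & \bigcup_(A <- r) A].
  elim: r => [|A r IHr] /=; first by rewrite big_nil -setI_eq0 setI0 eqxx.
  by rewrite big_cons IHr -!setI_eq0 setIUr setU_eq0.
rewrite /ordered_partition_of /= inE negb_or eq_sym -!andbA big_cons disjE.
case: (B != set0) => //=; rewrite !(andbCA _ (set0 \notin s)).
congr (_ && _); rewrite (andbC [disjoint _ & _]) -andbA.
rewrite !(andbCA _ (pairwise _ s)); congr (_ && _).
apply/andP/andP => [[/eqP<- dis]|[BD /eqP->]].
  rewrite subsetUl setDUl setDv set0U; split=> //; apply/eqP/esym/setDidPl.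
  by rewrite disjoint_sym.
rewrite -{1}(setIidPr BD) setID eqxx disjoint_sym.
by case/subsetDP: (subxx (D :\: B)).
Qed.

(** N bounds the number of blocks, which makes the recursion structural; no
    ordered partition is missed as soon as N is at least the size of D. *)
Fixpoint ordered_partitions N D : seq (seq {set T}) :=
  if D == set0 then [:: [::]] else
  if N is N'.+1 then
    [seq B :: s |
        B <- enum [set B : {set T} | (B \subset D) && (B != set0)],
        s <- ordered_partitions N' (D :\: B)]
  else [::].

Lemma ordered_partitions_uniq N D : uniq (ordered_partitions N D).
Proof.
elim: N D => [|N IHN] D /=; case: ifP => // _.
apply: allpairs_uniq_dep => [|B _|]; rewrite ?enum_uniq ?IHN //.
by move=> [B s] [B' s'] _ _ /= [-> ->].
Qed.

Lemma card_setD_lt N D B :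
  B \subset D -> B != set0 -> #|D| <= N.+1 -> #|D :\: B| <= N.
Proof.
move=> BD B0 leN; rewrite cardsDS // leq_subLR (leq_trans leN) //.
by rewrite -add1n leq_add2r card_gt0.
Qed.

Lemma mem_ordered_partitions N D s :
  #|D| <= N -> (s \in ordered_partitions N D) = ordered_partition_of D s.
Proof.
elim: N D s => [|N IHN] D s /=.
  rewrite leqn0 cards_eq0 => /eqP->; rewrite eqxx inE.
  case: s => [|B s]; first by rewrite ordered_partition_of_nil !eqxx.
  rewrite ordered_partition_of_cons subset0.
  by case: (B == set0).
move=> leN; case: eqP => [->|/eqP D0].
  rewrite inE; case: s => [|B s]; first by rewrite ordered_partition_of_nil !eqxx.
  by rewrite ordered_partition_of_cons subset0; case: (B == set0).
apply/allpairsPdep/idP => [[B] [r] [] | ].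
  rewrite mem_enum inE => /andP[BD B0] rD ->.
  by rewrite ordered_partition_of_cons BD B0 -IHN // card_setD_lt.
case: s => [|B s]; first by rewrite ordered_partition_of_nil (negbTE D0).
rewrite ordered_partition_of_cons => /and3P[B0 BD sD].
by exists B, s; rewrite mem_enum inE BD B0 IHN // card_setD_lt.
Qed.

Lemma sum_subsets D (F : nat -> nat) :
  \sum_(B : {set T} | B \subset D) F #|B|
  = \sum_(j < #|D|.+1) 'C(#|D|, j) * F j.
Proof.
rewrite (partition_big (fun B : {set T} => inord #|B| : 'I_#|D|.+1) predT) //=.
apply: eq_bigr => j _; rewrite -cards_draws -sum_nat_const.
apply: eq_big => [B|B /andP[BD /eqP <-]]; last first.
  by rewrite inordK // ltnS subset_leq_card.
rewrite inE; case: (boolP (B \subset D)) => //= BD.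
by rewrite -val_eqE /= inordK // ltnS subset_leq_card.
Qed.

(** Grouping the ordered partitions of D by the size of their first block gives
    the recurrence of [tied_races_rec]. *)
Lemma count_ties (m k N : nat) D :
  0 < m -> #|D| <= N ->
  \sum_(s <- ordered_partitions N D) (nb_ties m s == k) = tied_races m k #|D|.
Proof.
move=> m_gt0; have tied0 j : tied_races m j 0 = (j == 0).
  rewrite tied_races_rec /binconv !big_ord1 /=.
  by case: j => [|j] //=; rewrite big_ord1 /long leqNgt m_gt0.
elim: N D k => [|N IHN] D k leN /=.
  move: leN; rewrite leqn0 cards_eq0 => /eqP->.
  by rewrite eqxx big_seq1 cards0 tied0 eq_sym.
case: eqP => [->|/eqP D0]; first by rewrite big_seq1 cards0 tied0 eq_sym.
(* The contribution of the ordered partitions with a given first block of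
   size j. *)
pose F j := long m j * (if k is k'.+1 then tied_races m k' (#|D| - j) else 0)
            + short m j * tied_races m k (#|D| - j).
transitivity (\sum_(B : {set T} | B \subset D) F #|B|).
  rewrite big_allpairs_dep big_enum /= [RHS](bigID (fun B => B != set0)) /=.
  (* The empty set is no block, and the weight F gives it is indeed 0. *)
  rewrite [X in _ = _ + X]big1 ?addn0 => [|B /andP[_ /negPn/eqP->]]; last first.
    by rewrite /F cards0 /long /short leqNgt m_gt0.
  apply: eq_big => [B|B]; rewrite inE // => /andP[BD B0].
  have leB := card_setD_lt BD B0 leN.
  have shortB : (1 <= #|B| <= m - 1) = (#|B| < m).
    by rewrite card_gt0 B0 subn1 -[in RHS](prednK m_gt0) ltnS.
  rewrite /F -cardsDS // /long /short shortB -(IHN _ k) //.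
  case: leqP => mB; rewrite /= ?mul0n ?mul1n ?addn0 ?add0n.
    case: k {F} => [|k]; first by rewrite big1 // => s _; rewrite /nb_ties /= mB.
    by rewrite -IHN //; apply: eq_bigr => s _; rewrite /nb_ties /= mB.
  by apply: eq_bigr.
rewrite (sum_subsets D F) tied_races_rec /binconv; case: k @F {IHN} => [|k] /=.
  rewrite cards_eq0 (negbTE D0) add0n; apply: eq_bigr => j _.
  by rewrite muln0.
by rewrite -big_split; apply: eq_bigr => j _; rewrite /= -mulnDr.
Qed.

End OrderedPartitions.

(** * The formula *)

Lemma raceE (m n k : nat) : 0 < m -> race m n k = tied_races m k n.
Proof.
move=> m_gt0; have cardT : #|[set: 'I_n]| = n by rewrite cardsT card_ord.
rewrite -{2}cardT -(@count_ties _ m k n) ?cardT // -big_mkcond sum1_count.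
rewrite -size_filter /race cardE -(size_map val).
apply/perm_size/uniq_perm => [||s].
- by rewrite map_inj_uniq ?enum_uniq //; apply: val_inj.
- by rewrite filter_uniq ?ordered_partitions_uniq.
rewrite mem_filter mem_ordered_partitions ?cardT // andbC.
apply/mapP/andP => [[r]|[op_s nb_s]].
  by rewrite mem_enum inE => /andP[? ?] ->.
have le_s : size s <= n by have := size_ordered_partition op_s; rewrite card_ord.
by exists (Bseq le_s); rewrite // mem_enum inE; apply/andP.
Qed.

Theorem theorem10 (m : nat) (m_gt0 : 0 < m) (n k : nat) (k_gt0 : 0 < k) :
  race m n 0 = small_races m n /\
  race m n k =
    \sum_(k * m <= l < n.+1)
      'C(n, l) * small_races m (n - l) *
      \sum_(t : {ffun 'I_k -> 'I_l.+1} |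
            (\sum_(i < k) t i == l) && [forall i, m <= t i])
        multinom l (fun i => t i) *
        \prod_(i < k)
          \sum_(m <= j < (t i).+1) 'C(t i, j) * small_races m (t i - j).
Proof.
rewrite !raceE // /tied_races !(binconvC (small_races m)); split.
  by rewrite binconv1n.
have longE i : binconv (long m) (small_races m) i
    = \sum_(m <= j < i.+1) 'C(i, j) * small_races m (i - j).
  rewrite big_geq_mkord big_mkcond; apply: eq_bigr => j _ /=.
  by rewrite /long; case: leqP => _; rewrite ?mul1n ?mul0n ?muln0.
have supp i : ~~ (m <= i) -> binconv (long m) (small_races m) i = 0.
  by rewrite -ltnNge longE => lt_im; rewrite big_geq.
rewrite big_geq_mkord [RHS]big_mkcond; apply: eq_bigr => l _ /=.
(* The sum runs from k * m because lower coefficients of (L A)^k are zero. *)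
rewrite -mulnA (mulnC (small_races _ _)); case: leqP => [_|lt_l]; last first.
  rewrite (@binpow_eq0 _ m) ?mul0n ?muln0 // => i.
  by rewrite ltnNge; apply: supp.
rewrite (binpow_support (P := leq m)) //; congr (_ * (_ * _)).
by apply: eq_bigr => t _; congr (_ * _); apply: eq_bigr => u _.
Qed.
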